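(* Let $u$ and $v$ be adjacent vertices of a graph $G$. Then $\gamma(G) \leq \gamma(G_{u,v,2}) \leq \gamma(G)+1$. Moreover: (A) $\gamma(G_{u,v,2}) = \gamma(G)+1$ if and only if one of the following holds: (i) both $u$ and $v$ are $\gamma$-bad vertices of $G$; (ii) at least one of $u$ and $v$ is $\gamma$-good in $G$, $u,v \notin V^-(G)$, and each $\gamma$-set of $G$ contains at most one of $u$ and $v$. (B) $\gamma(G_{u,v,2}) = \gamma(G)$ if and only if at least one of the following is true: (iii) there exists a $\gamma$-set of $G$ which contains both $u$ and $v$; (iv) at least one of $u$ and $v$ is in $V^-(G)$.
   Context: Graphs are finite and simple. $\gamma(H)$ denotes the domination number of a graph $H$; a $\gamma$-set of $H$ is a dominating set of $H$ of cardinality $\gamma(H)$. A vertex of $H$ is $\gamma$-good if it belongs to some $\gamma$-set of $H$, and $\gamma$-bad if it belongs to no $\gamma$-set of $H$. $V^-(H) = \{x \in V(H) \mid \gamma(H-x) < \gamma(H)\}$. For distinct vertices $u,v$ of $G$, $G_{u,v,2}$ is the graph obtained from $G$ by adding two new vertices $x_1,x_2$ and the edges $ux_1$, $x_1x_2$, $x_2v$ (the edge $uv$ of $G$, if present, is kept). *)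

(* Defs.v *)
From HB Require Import structures.
From mathcomp Require Import all_boot.

Set Implicit Arguments.
Unset Strict Implicit.
Unset Printing Implicit Defensive.

(* The vertex type may be empty, so that H - x is always a graph. *)
Record sgraph := SGraph {
  vertex :> finType;
  adj : rel vertex;
  adj_sym : symmetric adj;
  adj_irrefl : irreflexive adj
}.

Section Domination.
Variable H : sgraph.

Definition dominating (D : {set H}) : bool :=
  [forall x, (x \in D) || [exists y in D, adj y x]].

Lemma dominatingT : dominating [set: H].
Proof. by apply/forallP => x; rewrite inE. Qed.

(* By dominatingT the default value [set: H] satisfies the constraint, so
   this is a genuine minimum. *)
Definition gamma : nat :=
  #|[arg min_(D < [set: H] | dominating D) #|D|]|.

Lemma gammaP :
  (exists2 D : {set H}, dominating D & #|D| = gamma) /\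
  (forall D : {set H}, dominating D -> gamma <= #|D|).
Proof.
rewrite /gamma; case: arg_minnP => [|D domD minD]; first exact: dominatingT.
by split=> //; exists D.
Qed.

Definition gamma_set (D : {set H}) : bool :=
  dominating D && (#|D| == gamma).

Definition gamma_good (x : H) : bool :=
  [exists D : {set H}, gamma_set D && (x \in D)].

Definition gamma_bad (x : H) : bool :=
  [forall D : {set H}, gamma_set D ==> (x \notin D)].

End Domination.

Section VertexDeletion.
Variables (H : sgraph) (x : H).

Definition del_adj : rel {y : H | y != x} := fun a b => adj (val a) (val b).

Lemma del_adj_sym : symmetric del_adj.
Proof. by move=> a b; apply: adj_sym. Qed.

Lemma del_adj_irrefl : irreflexive del_adj.
Proof. by move=> a; apply: adj_irrefl. Qed.

Definition del_vertex : sgraph := SGraph del_adj_sym del_adj_irrefl.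

End VertexDeletion.

Definition Vminus (H : sgraph) : {set H} :=
  [set x : H | gamma (del_vertex x) < gamma H].

Section AddPath.
Variables (G : sgraph) (u v : G).

(* The new vertices are x_1 = inr false and x_2 = inr true. *)
Definition path2_adj : rel (G + bool) := fun a b =>
  match a, b with
  | inl y, inl z => adj y z
  | inl y, inr false | inr false, inl y => y == u
  | inl y, inr true | inr true, inl y => y == v
  | inr i, inr j => i != j
  end.

Lemma path2_adj_sym : symmetric path2_adj.
Proof. by move=> [y|[]] [z|[]] //=; apply: adj_sym. Qed.

Lemma path2_adj_irrefl : irreflexive path2_adj.
Proof. by move=> [y|[]] //=; apply: adj_irrefl. Qed.

(* G_{u,v,2}; the edge uv of G, if present, is kept. *)
Definition add_path2 : sgraph := SGraph path2_adj_sym path2_adj_irrefl.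

End AddPath.

(* Main.v *)
Require Import Defs.
From mathcomp Require Import all_boot.

Set Implicit Arguments.
Unset Strict Implicit.
Unset Printing Implicit Defensive.

(** Write a set of vertices of G_{u,v,2} as T together with some of x_1, x_2.
    If it dominates and contains neither x_1 nor x_2, then T dominates G and
    contains u and v; if it contains both, then T with v added dominates G,
    because u and v are adjacent; if it contains only x_1, then T dominates
    every vertex of G except perhaps u, and u is in V^- as soon as
    |T| < gamma(G).  Conversely, a gamma-set of G - u with x_1 added, or a
    gamma-set of G containing u and v, dominates G_{u,v,2}.
    Since vertices of V^- are gamma-good, the condition in (A) is the negation
    of the one in (B). *)

Section Domination.
Variable H : sgraph.
Implicit Types (D E : {set H}) (x : H).

Definition dominates D x := (x \in D) || [exists y in D, adj y x].

Lemma dominates_adj D x y : y \in D -> adj y x -> dominates D x.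
Proof. by move=> yD yx; apply/orP; right; apply/exists_inP; exists y. Qed.

Lemma sub_dominates D E x : D \subset E -> dominates D x -> dominates E x.
Proof.
move=> /subsetP sDE /orP[/sDE xE | /exists_inP[y /sDE yE yx]].
  by rewrite /dominates xE.
exact: dominates_adj yE yx.
Qed.

(** Domination of [H - x] phrased inside [H], which avoids the subtype; [D] may itself contain
    [x]. *)
Definition dominates_off x D := [forall (y | y != x), dominates D y].

Lemma dominating_setU1 x D : dominates_off x D -> dominating (x |: D).
Proof.
move/forall_inP => offD; apply/forallP => y; rewrite -/(dominates _ y).
have [-> | /offD] := eqVneq y x; first by rewrite /dominates setU11.
exact/sub_dominates/subsetUr.
Qed.

Lemma gamma_off x D : dominates_off x D -> gamma H <= #|D|.+1.
Proof.
move/dominating_setU1/(gammaP H).2/leq_trans; apply.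
by rewrite cardsU1 -add1n leq_add2r leq_b1.
Qed.

Lemma VminusP x :
  reflect (exists2 D, dominates_off x D & #|D| < gamma H) (x \in Vminus H).
Proof.
rewrite inE; apply: (iffP idP) => [lt_gamma | [D offD ltD]].
  have [[D domD cardD] _] := gammaP (del_vertex x).
  exists [set val y | y in D]; last by rewrite (card_imset _ val_inj) cardD.
  apply/forall_inP => y yx.
  have /orP[yD | /exists_inP[z zD zy]] := forallP domD (Sub y yx).
    by apply/orP; left; apply/imsetP; exists (Sub y yx).
  by apply: (@dominates_adj _ _ (val z)); rewrite ?imset_f.
(* If [x] were in [D], then [D] would dominate all of [H] with fewer than [gamma H] vertices. So [D]
   lies in [H - x]. *)
have xD : x \notin D.
  apply/negP => xD; have := (gammaP H).2 _ (dominating_setU1 offD).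
  by rewrite (setUidPr _) ?sub1set // leqNgt ltD.
pose E : {set del_vertex x} := [set y | val y \in D].
have domE : dominating E.
  apply/forallP => y; rewrite inE.
  have /orP[-> // | /exists_inP[z zD zy]] := forall_inP offD _ (valP y).
  have zx : z != x by apply: contraNneq xD => <-.
  by apply/orP; right; apply/exists_inP; exists (Sub z zx); rewrite ?inE.
apply: leq_ltn_trans ((gammaP _).2 _ domE) _; apply: leq_ltn_trans ltD.
rewrite -(card_imset _ val_inj); apply/subset_leq_card/subsetP => z /imsetP[y + ->].
by rewrite inE.
Qed.

(** Fewer than [gamma H] vertices dominate everything but [x], so adding [x] costs at most one
    vertex and yields a gamma-set through [x]. *)
Lemma Vminus_gamma_good x : x \in Vminus H -> gamma_good x.
Proof.
case/VminusP=> D /dominating_setU1 domD ltD; apply/existsP; exists (x |: D).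
rewrite /gamma_set domD setU11 andbT /= eqn_leq (gammaP H).2 // andbT.
by apply: leq_trans ltD; rewrite cardsU1 -add1n leq_add2r leq_b1.
Qed.

Lemma gamma_badN x : gamma_bad x = ~~ gamma_good x.
Proof. by rewrite negb_exists; apply: eq_forallb => D; rewrite negb_and implybE. Qed.

End Domination.

Section AddPath.
Variables (G : sgraph) (u v : G).
Local Notation G2 := (add_path2 u v).
Implicit Types (T : {set G}) (b c : bool).

(** The flags [b] and [c] record the membership of $x_1$ and $x_2$. *)
Definition path2_set T b c : {set G2} :=
  [set z : G + bool | match z with
                      | inl y => y \in T
                      | inr i => if i then c else b
                      end].

Lemma path2_setP (D : {set G2}) : exists T b c, D = path2_set T b c.
Proof.
exists [set y : G | (inl y : G2) \in D], ((inr false : G2) \in D),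
  ((inr true : G2) \in D).
by apply/setP => -[y | []]; rewrite !inE.
Qed.

Lemma card_path2_set T b c : #|path2_set T b c| = #|T| + b + c.
Proof.
rewrite -sum1_card big_mkcond big_sumType /= big_bool !inE.
rewrite -[#|T|]sum1_card [in RHS]big_mkcond /= -addnA [b + c]addnC.
by congr (_ + _); apply: eq_bigr => y _; rewrite inE.
Qed.

(** Outside help reaches only [u] (from $x_1$) and [v] (from $x_2$). The last two conjuncts express
    the closed neighbourhoods $\{x_1, x_2, u\}$ of $x_1$ and $\{x_1, x_2, v\}$ of $x_2$. *)
Lemma dominating_path2_set T b c :
  dominating (path2_set T b c) =
  [&& [forall y, [|| dominates T y, (y == u) && b | (y == v) && c]],
      [|| b, c | u \in T] & [|| b, c | v \in T]].
Proof.
apply/forallP/and3P => [dom | [/forallP domT dom1 dom2] [y | i]].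
- split.
  + apply/forallP => y; have := dom (inl y); rewrite inE.
    case/orP=> [yT | /exists_inP[[z | []]]]; rewrite ?inE /=.
    * by rewrite /dominates yT.
    * by move=> zT /(dominates_adj zT)->.
    * by move=> -> ->; rewrite !orbT.
    * by move=> -> ->; rewrite !orbT.
  + have := dom (inr false); rewrite inE.
    case/orP=> [-> // | /exists_inP[[z | []]]]; rewrite ?inE //=.
    * by move=> zT /eqP <-; rewrite zT !orbT.
    * by move=> ->; rewrite orbT.
  + have := dom (inr true); rewrite inE.
    case/orP=> [-> // | /exists_inP[[z | []]]]; rewrite ?inE ?orbT //=.
    * by move=> zT /eqP <-; rewrite zT !orbT.
    * by move=> ->.
- case/or3P: (domT y) => [/orP[yT | /exists_inP[z zT zy]] | | ].
  + by rewrite inE yT.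
  + by apply/orP; right; apply/exists_inP; exists (inl z); rewrite ?inE.
  + case/andP=> yu b1.
    by apply/orP; right; apply/exists_inP; exists (inr false); rewrite ?inE.
  + case/andP=> yv c1.
    by apply/orP; right; apply/exists_inP; exists (inr true); rewrite ?inE.
- case: i; rewrite inE.
  + case/or3P: dom2 => [b1 | -> // | vT]; apply/orP; right; apply/exists_inP.
      by exists (inr false); rewrite ?inE.
    by exists (inl v); rewrite ?inE /=.
  + case/or3P: dom1 => [-> // | c1 | uT]; apply/orP; right; apply/exists_inP.
      by exists (inr true); rewrite ?inE.
    by exists (inl u); rewrite ?inE /=.
Qed.

Lemma gamma_add_path2_le : gamma G2 <= (gamma G).+1.
Proof.
have [[D /forallP domD <-] _] := gammaP G.
(* The single vertex $x_1$ dominates both new vertices. *)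
have domE : dominating (path2_set D true false).
  by rewrite dominating_path2_set andbT; apply/forallP => y; rewrite /dominates domD.
by apply: leq_trans ((gammaP G2).2 _ domE) _; rewrite card_path2_set addn0 addn1.
Qed.

Lemma gamma_add_path2_le_gamma :
  (exists D : {set G}, [/\ gamma_set D, u \in D & v \in D]) \/
    (u \in Vminus G \/ v \in Vminus G) ->
  gamma G2 <= gamma G.
Proof.
case=> [[D [/andP[/forallP domD /eqP <-] uD vD]] | ].
  have domE : dominating (path2_set D false false).
    rewrite dominating_path2_set uD vD /= andbT.
    by apply/forallP => y; rewrite /dominates domD.
  by apply: leq_trans ((gammaP G2).2 _ domE) _; rewrite card_path2_set !addn0.
(* The strict bound on [D] leaves room for one new vertex, the neighbour of the vertex that [D] may
   miss. *)
case=> /VminusP[D /forall_inP offD ltD].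
- have domE : dominating (path2_set D true false).
    rewrite dominating_path2_set andbT; apply/forallP => y.
    by have [_ | /offD->] := eqVneq y u; rewrite ?orbT.
  by apply: leq_trans ((gammaP G2).2 _ domE) _; rewrite card_path2_set addn0 addn1.
- have domE : dominating (path2_set D false true).
    rewrite dominating_path2_set andbT; apply/forallP => y.
    by have [_ | /offD->] := eqVneq y v; rewrite ?orbT.
  by apply: leq_trans ((gammaP G2).2 _ domE) _; rewrite card_path2_set addn0 addn1.
Qed.

Lemma gamma_le_add_path2 :
  adj u v ->
  gamma G <= gamma G2 /\
  (gamma G2 = gamma G ->
   (exists D : {set G}, [/\ gamma_set D, u \in D & v \in D]) \/
     (u \in Vminus G \/ v \in Vminus G)).
Proof.
move=> uv; have [[D domD <-] _] := gammaP G2.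
have [T [b [c defD]]] := path2_setP D.
move: domD; rewrite {D}defD card_path2_set dominating_path2_set.
case: b c => [] [] /and3P[/forallP domT uT vT]; rewrite ?addn0 ?addn1.
(* Both $x_1$ and $x_2$ are present, so [gamma G2] is [#|T|.+2]. The set [v |: T] can miss only [u],
   which [v] dominates through the edge [uv]; hence [gamma G < gamma G2], and equality is
   impossible. *)
- have offT : dominates_off u (v |: T).
    apply/forall_inP => y yu; have [-> | yv] := eqVneq y v.
      by rewrite /dominates setU11.
    apply: (sub_dominates (subsetUr _ _)).
    by have := domT y; rewrite (negbTE yu) (negbTE yv) !orbF.
  have domvT : dominating (v |: T).
    apply/forallP => y; have [-> | /(forall_inP offT)//] := eqVneq y u.
    by apply: dominates_adj (setU11 _ _) _; rewrite adj_sym.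
  have lt_gamma : gamma G <= #|T|.+1.
    apply: leq_trans ((gammaP G).2 _ domvT) _.
    by rewrite cardsU1 -add1n leq_add2r leq_b1.
  split=> [|eq_gamma]; first exact: ltnW.
  by rewrite -eq_gamma ltnn in lt_gamma.
- have offT : dominates_off u T.
    apply/forall_inP => y yu.
    by have := domT y; rewrite (negbTE yu) andbF !orbF.
  split=> [|eq_gamma]; first exact: gamma_off offT.
  by right; left; apply/VminusP; exists T; rewrite // -eq_gamma.
- have offT : dominates_off v T.
    apply/forall_inP => y yv.
    by have := domT y; rewrite (negbTE yv) andbF !orbF.
  split=> [|eq_gamma]; first exact: gamma_off offT.
  by right; right; apply/VminusP; exists T; rewrite // -eq_gamma.
(* With no new vertex in the set, $x_1$ and $x_2$ must be dominated by [u] and [v], which therefore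
   lie in [T]. *)
- have domT' : dominating T.
    by apply/forallP => y; have := domT y; rewrite !andbF !orbF.
  split=> [|eq_gamma]; first exact: (gammaP G).2.
  by left; exists T; rewrite /gamma_set domT' eq_gamma eqxx.
Qed.

End AddPath.

Theorem theorem4 (G : sgraph) (u v : G) (uv : adj u v) :
  [/\ gamma G <= gamma (add_path2 u v) <= gamma G + 1,
      gamma (add_path2 u v) = gamma G + 1 <->
        (gamma_bad u /\ gamma_bad v) \/
        [/\ gamma_good u \/ gamma_good v,
            u \notin Vminus G /\ v \notin Vminus G
          & forall D : {set G}, gamma_set D -> ~ (u \in D /\ v \in D)]
    & gamma (add_path2 u v) = gamma G <->
        (exists D : {set G}, [/\ gamma_set D, u \in D & v \in D]) \/
        (u \in Vminus G \/ v \in Vminus G)].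
Proof.
have [le_gamma eq_gammaB] := gamma_le_add_path2 uv.
have leB := @gamma_add_path2_le_gamma G u v.
have le_gamma1 := gamma_add_path2_le u v.
rewrite addn1; split; first by rewrite le_gamma.
- split=> [eq_gamma1 | A].
    have notB : ~ ((exists D : {set G}, [/\ gamma_set D, u \in D & v \in D]) \/
                   (u \in Vminus G \/ v \in Vminus G)).
      by move/leB; rewrite eq_gamma1 ltnn.
    rewrite !gamma_badN.
    (* If both vertices are bad, (i) holds; otherwise the remaining clauses of (ii) are the negation
       of (iii) and (iv). *)
    have [good | /norP] := boolP (gamma_good u || gamma_good v); last by left.
    right; split; first exact/orP.
      by split; apply/negP => Vm; apply: notB; right; [left | right].
    by move=> D gD [uD vD]; apply: notB; left; exists D.
  (* By the two bounds it suffices to exclude equality with [gamma G], which would give (iii) or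
     (iv). Either of these makes [u] or [v] good, against (i), and contradicts (ii) directly. *)
  apply/eqP; rewrite eqn_leq le_gamma1 ltn_neqAle le_gamma andbT /=.
  apply/eqP => /esym/eq_gammaB B; move: A; rewrite !gamma_badN.
  case=> [[/negP badu /negP badv] | [_ [/negP uV /negP vV] notD]].
    case: B => [[D [gD uD _]] | [/Vminus_gamma_good // | /Vminus_gamma_good //]].
    by apply: badu; apply/existsP; exists D; rewrite gD.
  by case: B => [[D [gD uD vD]] | [// | //]]; apply: (notD D).
- split=> [/eq_gammaB // | /leB le_gamma'].
  by apply/eqP; rewrite eqn_leq le_gamma'.
Qed.
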